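(* Let $P$ be the transition kernel of a $\pi$-irreducible Markov chain with invariant probability measure $\pi$, and let $\widetilde P$ be a transition kernel on the same space (a perturbation of $P$) with invariant probability measure $\widetilde\pi$. Let $\{\gamma_n: n\in\mathbb{Z}_+\}$ be a positive sequence, put $\Gamma_n:=\sum_{m=0}^{n-1}\gamma_m$, and suppose $\Gamma_\infty:=\sum_{m=0}^{\infty}\gamma_m<\infty$. Assume that $\|P^n-\pi\|\le\gamma_n$ for all $n\ge 0$. Then $$\|\widetilde P^n-P^n\|\le\Gamma_n\|\widetilde P-P\|\quad (n\ge 1),\qquad\text{and}\qquad \|\widetilde\pi-\pi\|_{\mathrm{Var}}\le\Gamma_\infty\|\widetilde P-P\|.$$
   Context: $\Phi=\{\Phi_n:n\in\mathbb{Z}_+\}$ is a discrete-time homogeneous Markov chain on a general state space $X$ with countably generated $\sigma$-field $\mathscr{B}(X)$, with $n$-step transition kernel $P^n(x,B)=\mathbb{P}_x\{\Phi_n\in B\}$ ($P=P^1$), where $\mathbb{P}_x$ is the probability given $\Phi_0=x$. The chain has a (unique) invariant probability measure $\pi$ and is $\pi$-irreducible: if $\pi(B)>0$, there exists $n\in\mathbb{N}$ such that $P^n(x,B)>0$ for all $x\in X$. For a signed measure $\mu$ on $\mathscr{B}(X)$, $\|\mu\|_{\mathrm{Var}}=\sup_{|f|\le 1}|\mu(f)|$ (supremum over measurable $f$ with $|f|\le1$), where $\mu(f)=\int_X f\,d\mu$. For kernels, $\|P^n-\pi\|=\sup_{x\in X}\|P^n(x,\cdot)-\pi\|_{\mathrm{Var}}$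 and $\|\widetilde P^n-P^n\|=\sup_{x\in X}\|\widetilde P^n(x,\cdot)-P^n(x,\cdot)\|_{\mathrm{Var}}$. *)

(* Defs.v *)
From HB Require Import structures.
From mathcomp Require Import all_boot all_order all_algebra.
From mathcomp Require Import all_classical all_reals all_analysis.

Set Implicit Arguments.
Unset Strict Implicit.
Unset Printing Implicit Defensive.

Import Order.TTheory GRing.Theory Num.Theory.
Import numFieldNormedType.Exports.

Local Open Scope classical_set_scope.
Local Open Scope ring_scope.
Local Open Scope ereal_scope.

Definition countably_generated (d : measure_display) (X : measurableType d) :=
  exists G : set (set X), countable G /\ <<s G >> = @measurable d X.

(* The library composes subprobability kernels; the composition of two
   probability kernels, x |-> \int[k1 x]_y k2 y _, is again a probability
   kernel. *)
Section pker_comp.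
Context d0 d1 d2 (T0 : measurableType d0) (T1 : measurableType d1)
  (T2 : measurableType d2) (R : realType).
Variables (k1 : R.-pker T0 ~> T1) (k2 : R.-pker T1 ~> T2).

Definition pker_comp : T0 -> {measure set T2 -> \bar R} :=
  mkcomp_noparam k1 k2.

HB.instance Definition _ := Kernel.on pker_comp.

Let pker_comp_prob x : pker_comp x [set: T2] = 1.
Proof.
rewrite /pker_comp /mkcomp_noparam /= /kcomp_noparam.
under eq_integral do rewrite prob_kernel.
by rewrite integral_cst// mul1e prob_kernel.
Qed.

HB.instance Definition _ :=
  Kernel_isProbability.Build _ _ _ _ _ pker_comp pker_comp_prob.

End pker_comp.

Section kernel_pow.
Context d (X : measurableType d) (R : realType).
Variable P : R.-pker X ~> X.

(* P^0(x, _) = \d_x and P^(n+1)(x, B) = \int P(x, dy) P^n(y, B) *)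
Fixpoint kpow (n : nat) : R.-pker X ~> X :=
  if n is m.+1 then pker_comp P (kpow m)
  else kdirac (@measurable_id _ X setT).

End kernel_pow.

Section kernel_at.
Context d d' (X : measurableType d) (Y : measurableType d') (R : realType).
Variables (k : R.-pker X ~> Y) (x : X).

Definition kernel_at : set Y -> \bar R := k x.

HB.instance Definition _ := Measure.on kernel_at.

HB.instance Definition _ :=
  Measure_isProbability.Build _ _ _ kernel_at (prob_kernel x).

End kernel_at.

Section variation.
Context d (X : measurableType d) (R : realType).
Implicit Types nu : {charge set X -> \bar R}.

Lemma hahn_ex nu :
  exists PN : set X * set X, hahn_decomposition nu PN.1 PN.2.
Proof. by have [P [N h]] := Hahn_decomposition nu; exists (P, N). Qed.

(* nu(f) = nu^+(f) - nu^-(f), for the Jordan decomposition of nu; it does not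
   depend on the chosen Hahn decomposition *)
Definition charge_integral nu (f : X -> R) : \bar R :=
  let nuPN := projT2 (cid (hahn_ex nu)) in
  \int[jordan_pos nuPN]_x (f x)%:E - \int[jordan_neg nuPN]_x (f x)%:E.

Definition var_norm nu : \bar R :=
  ereal_sup [set `|charge_integral nu f| | f in
    [set f : X -> R | measurable_fun [set: X] f /\
                      forall x, (`|f x| <= 1)%R]].

Definition kernel_norm (K : X -> {charge set X -> \bar R}) : \bar R :=
  ereal_sup [set var_norm (K x) | x in [set: X]].

Definition prob_sub (p q : probability X R) : {charge set X -> \bar R} :=
  cadd (charge_of_finite_measure p) (copp (charge_of_finite_measure q)).

End variation.

Section markov.
Context d (X : measurableType d) (R : realType).
Implicit Types (P : R.-pker X ~> X) (p q : probability X R).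

Definition invariant_prob P p :=
  forall B, measurable B -> \int[p]_x P x B = p B.

Definition unique_invariant_prob P p :=
  invariant_prob P p /\
  forall q, invariant_prob P q -> forall B, measurable B -> q B = p B.

Definition pi_irreducible P p :=
  forall B, measurable B -> 0 < p B ->
    exists n : nat, (0 < n)%N /\ forall x, 0 < kpow P n x B.

End markov.

(* Main.v *)
(* Write P^n f(x) for the integral of f against P^n(x, _), and Pt for the
   perturbed kernel. For |f| <= 1,
     Pt^(n+1) f - P^(n+1) f = Pt (Pt^n f - P^n f) + (Pt - P)(P^n f - pi f),
   because Pt - P kills the constant pi f. The second term is at most
   gamma_n * ||Pt - P||, and the first does not exceed the bound at rank n, so
   the bounds add up to Gamma_n * ||Pt - P||. Integrating against pit, which is
   invariant under Pt^n, gives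
     |pit f - pi f| <= Gamma_n * ||Pt - P|| + gamma_n,
   and gamma_n tends to 0. *)
Require Import Defs.
From HB Require Import structures.
From mathcomp Require Import all_boot all_order all_algebra.
From mathcomp Require Import all_classical all_reals all_analysis.
From mathcomp Require Import measurable_realfun giry lra.

Set Implicit Arguments.
Unset Strict Implicit.
Unset Printing Implicit Defensive.

Import Order.TTheory GRing.Theory Num.Theory.
Import numFieldNormedType.Exports.

Local Open Scope classical_set_scope.
Local Open Scope ring_scope.
Local Open Scope ereal_scope.

(** * Variation norm of a difference of probabilities, tested on bounded functions *)

Section bounded_functions.
Context d (X : measurableType d) (R : realType).
Implicit Types (p q : probability X R) (f : X -> R).

Lemma integrable_bounded (mu : {finite_measure set X -> \bar R}) f (M : R) :
  measurable_fun [set: X] f -> (forall x, (`|f x| <= M)%R) ->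
  mu.-integrable [set: X] (EFin \o f).
Proof.
move=> mf fM; apply: measurable_bounded_integrable => //.
  by rewrite ltey_eq fin_num_measure.
exists M; split; first exact: num_real.
by move=> r Mr x _; exact: le_trans (fM x) (ltW Mr).
Qed.

Lemma Rintegral_prob_cst p (c : R) : (\int[p]__ c)%R = c.
Proof. rewrite Rintegral_cst// -[RHS]mulr1; congr *%R.
exact: (congr1 fine (probability_setT p)). Qed.

Lemma normr_Rintegral_prob_le p f (M : R) :
  measurable_fun [set: X] f -> (forall x, (`|f x| <= M)%R) ->
  (`|\int[p]_x f x| <= M)%R.
Proof.
move=> mf fM; have fi := integrable_bounded p mf fM.
apply: (le_trans (le_normr_Rintegral _ fi)) => //.
rewrite -[leRHS](Rintegral_prob_cst p); apply: le_Rintegral => //.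
- exact: (integrable_norm fi).
- exact: finite_measure_integrable_cst.
Qed.

(** Trades an identity between signed differences for one between sums, which are again integrals
    against measures. *)
Lemma sube_eq_sube (a b c e : \bar R) :
  a \is a fin_num -> b \is a fin_num -> c \is a fin_num -> e \is a fin_num ->
  (a - b = c - e) <-> (a + e = c + b).
Proof.
case: a b c e => [a| |] [b| |] [c| |] [e| |]// _ _ _ _.
by split=> -[h]; congr EFin; lra.
Qed.

(** If $\nu^+$ and $\nu^-$ are the Jordan parts of [p - q], then $\nu^+ + q = p + \nu^-$ as
    measures; integrating [f] against both sides gives the formula, whichever Hahn decomposition was
    chosen. *)
Lemma charge_integral_prob_sub p q f (M : R) :
  measurable_fun [set: X] f -> (forall x, (`|f x| <= M)%R) ->
  charge_integral (prob_sub p q) f = (\int[p]_x f x - \int[q]_x f x)%R%:E.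
Proof.
move=> mf fM; rewrite /charge_integral; set hPN := projT2 _.
have ip := integrable_bounded p mf fM.
have iq := integrable_bounded q mf fM.
have imp := integrable_bounded (jordan_pos hPN) mf fM.
have imn := integrable_bounded (jordan_neg hPN) mf fM.
have mfE := measurable_int _ ip.
rewrite EFinB !fineK; [|exact: integrable_fin_num iq|exact: integrable_fin_num ip].
apply/sube_eq_sube; try exact: (integrable_fin_num measurableT).
rewrite -!integral_measure_add//; apply: eq_measure_integral => E mE _.
rewrite [LHS]measure_addE [RHS]measure_addE; apply/sube_eq_sube.
1-4: exact: fin_num_measure.
have := jordan_decomp hPN mE.
rewrite [X in _ = X -> _]/cadd [X in _ = X -> _]/= cscaleN1.
exact: esym.
Qed.

Lemma var_norm_prob_sub_le p q (C : \bar R) :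
  (forall f, measurable_fun [set: X] f -> (forall x, (`|f x| <= 1)%R) ->
    `|\int[p]_x f x - \int[q]_x f x|%R%:E <= C) ->
  var_norm (prob_sub p q) <= C.
Proof.
move=> h; apply: ge_ereal_sup => _ [f [mf f1] <-].
by rewrite (charge_integral_prob_sub _ _ mf f1)/=; exact: h.
Qed.

(** By homogeneity: [M^-1 * f] is admissible in the supremum. Taking [M] to be [gamma n] later
    produces the factor [gamma n]. *)
Lemma normr_Rintegral_sub_le p q f (M C : R) : (0 < M)%R ->
  var_norm (prob_sub p q) <= C%:E ->
  measurable_fun [set: X] f -> (forall x, (`|f x| <= M)%R) ->
  (`|\int[p]_x f x - \int[q]_x f x| <= M * C)%R.
Proof.
move=> M0 hC mf fM.
have mg : measurable_fun [set: X] (fun x => M^-1 * f x)%R.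
  by apply: measurable_funM => //; exact: measurable_cst.
have g1 x : (`|M^-1 * f x| <= 1)%R.
  by rewrite normrM gtr0_norm ?invr_gt0// mulrC ler_pdivrMr// mul1r.
have : `|charge_integral (prob_sub p q) (fun x => M^-1 * f x)%R| <= C%:E.
  apply: le_trans hC; apply: ereal_sup_ubound.
  by exists (fun x => M^-1 * f x)%R.
rewrite (charge_integral_prob_sub _ _ mg g1)/=.
rewrite !RintegralZl//; try exact: integrable_bounded fM.
rewrite -mulrBr lee_fin normrM gtr0_norm ?invr_gt0//.
by rewrite mulrC ler_pdivrMr// mulrC.
Qed.

(** Ensures that the norm of [Pt - P] is finite. *)
Lemma var_norm_prob_sub_le2 p q : var_norm (prob_sub p q) <= 2%:E.
Proof.
apply: var_norm_prob_sub_le => f mf f1; rewrite lee_fin.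
apply: (le_trans (ler_normB _ _)).
by apply: lerD; exact: normr_Rintegral_prob_le.
Qed.

Lemma var_norm_prob_sub_ge0 p q : 0 <= var_norm (prob_sub p q).
Proof.
apply: le_trans (ereal_sup_ubound _); last first.
  by exists (cst 0%R) => //; split=> [|x]; [exact: measurable_cst|rewrite normr0].
exact: abse_ge0.
Qed.

End bounded_functions.

(** * Integration against kernels and mixtures *)

Section kernel_integrals.
Context d (X : measurableType d) (R : realType).
Implicit Types (p q : probability X R) (k : R.-pker X ~> X) (f : X -> R).

Lemma measurable_kernel_at k : measurable_fun [set: X]
  (fun x => (kernel_at k x : giry X R)).
Proof.
by apply: measurable_giry_codensity => //= B mB; exact: measurable_kernel.
Qed.

(** The hypothesis says that [q] is the Giry bind of [p] along [k], whose integrals are iterated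
    integrals. *)
Lemma ge0_integral_mixture p q k (h : X -> \bar R) :
  (forall B, measurable B -> q B = \int[p]_y k y B) ->
  measurable_fun [set: X] h -> (forall x, 0 <= h x) ->
  \int[q]_x h x = \int[p]_y \int[kernel_at k y]_x h x.
Proof.
move=> qE mh h0.
have bindE g : measurable_fun [set: X] g -> (forall x, 0 <= g x) ->
    \int[giry_bind (p : giry X R) (measurable_kernel_at k)]_x g x =
    \int[p]_y \int[kernel_at k y]_x g x.
  by move=> mg g0; exact: giry_int_bind.
rewrite -bindE//; apply: eq_measure_integral => B mB _.
have mI : measurable_fun [set: X] (fun x => (\1_B x)%:E : \bar R).
  exact/measurable_EFinP/measurable_indic.
(* On the indicator of [B] the bind formula returns the integral of [k y B], that is, [q B]. *)
rewrite -[X in _ = _ X](setIT B) -integral_indic// bindE//.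
apply: (etrans (qE B mB)); apply: eq_integral => y _.
by rewrite integral_indic// setIT.
Qed.

Lemma measurable_Rintegral_kernel k f :
  measurable_fun [set: X] f ->
  measurable_fun [set: X] (fun y => \int[kernel_at k y]_x f x)%R.
Proof.
move=> mf; apply: measurableT_comp => //=.
have mfE := (measurable_EFinP _ _).2 mf.
under eq_fun do rewrite integralE.
apply: emeasurable_funB;
  apply: (measurable_fun_integral_kernel (l := kernel_at k)) => //.
- by move=> U mU; exact: measurable_kernel.
- exact: measurable_funepos.
- by move=> U mU; exact: measurable_kernel.
- exact: measurable_funeneg.
Qed.

(** Serves both the recursion for kernel powers and invariance, where [p] and [q] coincide. *)
Lemma Rintegral_mixture p q k f (M : R) :
  (forall B, measurable B -> q B = \int[p]_y k y B) ->
  measurable_fun [set: X] f -> (forall x, (`|f x| <= M)%R) ->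
  (\int[q]_x f x = \int[p]_y \int[kernel_at k y]_x f x)%R.
Proof.
move=> qE mf fM.
(* The nonnegative case applies to [f + M]. *)
have mfM : measurable_fun [set: X] (fun x => f x + M)%R.
  by apply: measurable_funD => //; exact: measurable_cst.
have fM0 x : (0 <= f x + M)%R.
  by have := fM x; rewrite ler_norml => /andP[+ _]; rewrite -lerBlDr sub0r.
have shift (r : probability X R) : (\int[r]_x (f x + M) = \int[r]_x f x + M)%R.
  rewrite RintegralD// ?Rintegral_prob_cst//; first exact: integrable_bounded fM.
  exact: finite_measure_integrable_cst.
have mK := measurable_Rintegral_kernel k mf.
have KM y : (`|\int[kernel_at k y]_x f x| <= M)%R.
  exact: normr_Rintegral_prob_le.
apply: (addIr M); rewrite -shift -[in RHS](Rintegral_prob_cst p M).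
rewrite -RintegralD//; [|exact: integrable_bounded KM
                        |exact: finite_measure_integrable_cst].
rewrite /Rintegral (ge0_integral_mixture qE)//; last exact/measurable_EFinP.
congr fine; apply: eq_integral => y _; rewrite -[in RHS]shift.
rewrite /Rintegral fineK//; apply: (integrable_fin_num measurableT).
(* The bound [M + M] relies on [0 <= M], which holds because [M] dominates [|f x|]. *)
apply: (@integrable_bounded _ _ _ (kernel_at k y) _ (M + M)%R) => // x.
by apply: (le_trans (ler_normD _ _)); rewrite lerD// ger0_norm//
  (le_trans _ (fM x)).
Qed.

End kernel_integrals.

(** * Perturbation bounds for a single test function *)

Section perturbation.
Context d (X : measurableType d) (R : realType).
Variables (P Pt : R.-pker X ~> X) (pi : probability X R).
Variables (gamma : nat -> R) (D : R).
Hypothesis gamma_gt0 : forall n, (0 < gamma n)%R.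
Hypothesis hgamma : forall n x,
  var_norm (prob_sub (kernel_at (kpow P n) x) pi) <= (gamma n)%:E.
Hypothesis hD : forall x,
  var_norm (prob_sub (kernel_at Pt x) (kernel_at P x)) <= D%:E.

Lemma normr_Rintegral_kpow_sub_pi n (f : X -> R) x :
  measurable_fun [set: X] f -> (forall x, (`|f x| <= 1)%R) ->
  (`|\int[kernel_at (kpow P n) x]_y f y - \int[pi]_y f y| <= gamma n)%R.
Proof.
move=> mf f1; rewrite -[leRHS]mul1r.
exact: (normr_Rintegral_sub_le ltr01 (hgamma n x)).
Qed.

Lemma normr_Rintegral_kpow_sub n (f : X -> R) x :
  measurable_fun [set: X] f -> (forall x, (`|f x| <= 1)%R) ->
  (`|\int[kernel_at (kpow Pt n) x]_y f y -
     \int[kernel_at (kpow P n) x]_y f y| <= (\sum_(0 <= m < n) gamma m) * D)%R.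
Proof.
(* The starting point stays general, since the induction hypothesis is integrated over it. *)
move=> mf f1; elim: n x => [|n IHn] x.
  by rewrite big_geq// mul0r subrr normr0.
pose g y := (\int[kernel_at (kpow P n) y]_z f z)%R.
pose gt y := (\int[kernel_at (kpow Pt n) y]_z f z)%R.
pose c := (\int[pi]_z f z)%R.
have mg : measurable_fun [set: X] g by exact: measurable_Rintegral_kernel.
have mgt : measurable_fun [set: X] gt by exact: measurable_Rintegral_kernel.
have g1 y : (`|g y| <= 1)%R by exact: normr_Rintegral_prob_le.
have gt1 y : (`|gt y| <= 1)%R by exact: normr_Rintegral_prob_le.
have -> : (\int[kernel_at (kpow P n.+1) x]_y f y = \int[kernel_at P x]_y g y)%R.
  exact: (Rintegral_mixture _ mf f1).
have -> : (\int[kernel_at (kpow Pt n.+1) x]_y f y =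
    \int[kernel_at Pt x]_y gt y)%R.
  exact: (Rintegral_mixture _ mf f1).
(* Probabilities integrate [c] to itself, so [g - c] may replace [g]; its bound is [gamma n] instead
   of 1. *)
have mgc : measurable_fun [set: X] (fun y => g y - c)%R.
  by apply: measurable_funB => //; exact: measurable_cst.
have gc y : (`|g y - c| <= gamma n)%R by exact: normr_Rintegral_kpow_sub_pi.
have shift (r : probability X R) : (\int[r]_y (g y - c) = \int[r]_y g y - c)%R.
  rewrite RintegralB// ?Rintegral_prob_cst//; first exact: integrable_bounded g1.
  exact: finite_measure_integrable_cst.
have mdiff : measurable_fun [set: X] (fun y => gt y - g y)%R.
  exact: measurable_funB.
(* The intermediate term is [Pt] applied to [g]. *)
rewrite -(subrKA (\int[kernel_at Pt x]_y g y)%R) big_nat_recr//= mulrDl.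
apply: (le_trans (ler_normD _ _)); apply: lerD.
  rewrite -RintegralB//; [|exact: integrable_bounded gt1
                          |exact: integrable_bounded g1].
  exact: normr_Rintegral_prob_le.
have := normr_Rintegral_sub_le (gamma_gt0 n) (hD x) mgc gc.
by rewrite !shift opprB addrA subrK.
Qed.

Lemma normr_Rintegral_invariant_sub (pit : probability X R) n (f : X -> R) :
  invariant_prob Pt pit ->
  measurable_fun [set: X] f -> (forall x, (`|f x| <= 1)%R) ->
  (`|\int[pit]_y f y - \int[pi]_y f y|
    <= (\sum_(0 <= m < n) gamma m) * D + gamma n)%R.
Proof.
move=> hpit mf f1.
pose gt m y := (\int[kernel_at (kpow Pt m) y]_z f z)%R.
have mgt m : measurable_fun [set: X] (gt m) by exact: measurable_Rintegral_kernel.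
have gt1 m y : (`|gt m y| <= 1)%R by exact: normr_Rintegral_prob_le.
(* Invariance under every power: [Pt] is inserted once by invariance, then absorbed into the next
   power. *)
have pitE : (\int[pit]_y f y = \int[pit]_y gt n y)%R.
  elim: n => [|n ->].
    apply: (Rintegral_mixture _ mf f1) => B mB /=.
    by rewrite -[X in _ X = _]setIT -[LHS]integral_indic.
  rewrite (Rintegral_mixture (p := pit) (k := Pt) _ (mgt n) (gt1 n));
    last by move=> B mB; exact/esym/hpit.
  apply: eq_Rintegral => y _; symmetry.
  exact: (Rintegral_mixture _ mf f1).
pose c := (\int[pi]_z f z)%R.
(* With [c] written as an integral against [pit], a pointwise bound suffices. *)
rewrite pitE -/c -[X in (_ - X)%R](Rintegral_prob_cst pit c).
rewrite -RintegralB//; [|exact: integrable_bounded (gt1 n)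
                        |exact: finite_measure_integrable_cst].
apply: normr_Rintegral_prob_le.
  by apply: measurable_funB => //; exact: measurable_cst.
move=> y; rewrite -(subrKA (\int[kernel_at (kpow P n) y]_z f z)%R).
apply: (le_trans (ler_normD _ _)); apply: lerD.
  exact: normr_Rintegral_kpow_sub.
exact: normr_Rintegral_kpow_sub_pi.
Qed.

End perturbation.

(** * From test functions to norms, and the limit in [n] *)

Theorem theorem2p1 (R : realType) (d : measure_display) (X : measurableType d)
  (P Pt : R.-pker X ~> X) (pi pit : probability X R) (gamma : nat -> R)
  (hX : countably_generated X)
  (hpi : unique_invariant_prob P pi)
  (hirr : pi_irreducible P pi)
  (hpit : invariant_prob Pt pit)
  (gamma_gt0 : forall n, (0 < gamma n)%R)
  (gamma_sum : \sum_(0 <= m <oo) (gamma m)%:E < +oo)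
  (hgamma : forall n,
    kernel_norm (fun x => prob_sub (kernel_at (kpow P n) x) pi)
      <= (gamma n)%:E) :
  (forall n, (1 <= n)%N ->
    kernel_norm (fun x =>
      prob_sub (kernel_at (kpow Pt n) x) (kernel_at (kpow P n) x))
    <= (\sum_(0 <= m < n) gamma m)%R%:E *
       kernel_norm (fun x => prob_sub (kernel_at Pt x) (kernel_at P x)))
  /\
  var_norm (prob_sub pit pi)
    <= (\sum_(0 <= m <oo) (gamma m)%:E) *
       kernel_norm (fun x => prob_sub (kernel_at Pt x) (kernel_at P x)).
Proof.
set Delta := kernel_norm _.
have hDelta x : var_norm (prob_sub (kernel_at Pt x) (kernel_at P x)) <= Delta.
  by apply: ereal_sup_ubound; exists x.
(* A space carrying a probability is nonempty; over an empty space the supremum [Delta] would be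
   [-oo]. *)
have [x0 _] : [set: X] !=set0.
  apply/set0P/eqP => X0; have := probability_setT pi.
  rewrite [X in pi X]X0 measure0 => /eqP.
  by rewrite eqe eq_sym oner_eq0.
have Delta_ge0 : 0 <= Delta.
  exact: le_trans (var_norm_prob_sub_ge0 _ _) (hDelta x0).
have Delta_fin : Delta \is a fin_num.
  rewrite ge0_fin_numE// (@le_lt_trans _ _ 2%:E) ?ltry//.
  by apply: ge_ereal_sup => _ [x _ <-]; exact: var_norm_prob_sub_le2.
move: Delta_fin Delta_ge0 hDelta; case: Delta => [D| |]// _ D0 hD.
have hg n x : var_norm (prob_sub (kernel_at (kpow P n) x) pi) <= (gamma n)%:E.
  by apply: le_trans (hgamma n); apply: ereal_sup_ubound; exists x.
split=> [n _|].
  apply: ge_ereal_sup => _ [x _ <-]; apply: var_norm_prob_sub_le => f mf f1.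
  by rewrite -EFinM lee_fin; exact: (normr_Rintegral_kpow_sub gamma_gt0 hg hD).
have G0 : 0 <= \sum_(0 <= m <oo) (gamma m)%:E.
  by apply: nneseries_ge0 => n _ _; rewrite lee_fin ltW.
have Gfin : \sum_(0 <= m <oo) (gamma m)%:E \is a fin_num.
  by rewrite ge0_fin_numE.
have leG n :
    (\sum_(0 <= m < n) gamma m <= fine (\sum_(0 <= m <oo) (gamma m)%:E))%R.
  rewrite -lee_fin fineK// -sumEFin; apply: nneseries_lim_ge => m _ _.
  by rewrite lee_fin ltW.
have gamma_cvg0 : gamma n @[n --> \oo] --> (0 : R)%R.
  apply: cvg_series_cvg_0; apply: nnseries_is_cvg => // n.
  exact: ltW.
apply: var_norm_prob_sub_le => f mf f1.
rewrite -(fineK Gfin) -EFinM lee_fin; set G := fine _ in leG *.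
(* The left side of the goal does not depend on [n], so a bound valid at every rank passes to the
   limit. *)
have cvg_bound : (G * D + gamma n)%R @[n --> \oo] --> (G * D + 0)%R.
  by apply: cvgD => //; exact: cvg_cst.
rewrite -[leRHS]addr0; apply: (cvgr_to_ge cvg_bound); apply: nearW => n.
apply: (le_trans (normr_Rintegral_invariant_sub gamma_gt0 hg hD n hpit mf f1)).
by rewrite lerD2r ler_wpM2r.
Qed.
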